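(* Let $q$ be a prime power, let $n_1,n_2$ be positive integers, and let $k_1,k_2$ be positive integers such that, for each $i\in\{1,2\}$, the projective space $\mathrm{PG}(n_i,q)$ contains a minimal blocking set of size $k_i$. Then $\mathrm{PG}(n_1+n_2+1,q)$ contains a minimal blocking set of size $k_1+k_2-1$.
   Context: For a positive integer $n$ and a prime power $q$, $\mathrm{PG}(n,q)$ denotes the $n$-dimensional projective space over the finite field $\mathbb{F}_q$ of order $q$ (its points are the one-dimensional subspaces of $\mathbb{F}_q^{n+1}$ and its hyperplanes correspond to the $n$-dimensional subspaces of $\mathbb{F}_q^{n+1}$). A blocking set in $\mathrm{PG}(n,q)$ is a set of points that has non-empty intersection with every hyperplane of $\mathrm{PG}(n,q)$. A blocking set is called minimal if none of its proper subsets is a blocking set. *)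

(* Defs.v *)
From HB Require Import structures.
From mathcomp Require Import all_boot all_algebra.

Set Implicit Arguments.
Unset Strict Implicit.
Unset Printing Implicit Defensive.

Import GRing.Theory VectorInternalTheory.
Local Open Scope ring_scope.

HB.instance Definition _ (F : finFieldType) (vT : vectType F) :=
  [Countable of {vspace vT} by <:].
HB.instance Definition _ (F : finFieldType) (vT : vectType F) :=
  [Finite of {vspace vT} by <:].

Section ProjectiveSpace.

Variables (F : finFieldType) (n : nat).

(* The subspaces of F^(n+1) of vector-space dimension d; projectively they
   have dimension d - 1. *)
Definition pg_subspace (d : nat) : Type :=
  {U : {vspace 'rV[F]_n.+1} | \dim U == d}.

HB.instance Definition _ d := SubFinite.on (pg_subspace d).

Definition pg_point : finType := pg_subspace 1.
Definition pg_hyperplane : finType := pg_subspace n.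

Definition incident (P : pg_point) (H : pg_hyperplane) : bool :=
  (val P <= val H)%VS.

Definition blocking_set (B : {set pg_point}) : bool :=
  [forall H : pg_hyperplane, exists P in B, incident P H].

Definition minimal_blocking_set (B : {set pg_point}) : bool :=
  minset blocking_set B.

End ProjectiveSpace.

Arguments pg_point : clear implicits.
Arguments pg_hyperplane : clear implicits.

(* Main.v *)
(** Place the two spaces as complementary subspaces of the large one, pick a
    point in each minimal blocking set, say [P1 = <p1>] and [P2 = <p2>], and
    replace [P1] and [P2] by the single point [<p1 + p2>].  A functional that
    vanishes nowhere on the remaining points restricts to functionals
    vanishing at [p1] and at [p2], hence at [p1 + p2].  Conversely, a functional
    on the large space is a pair [(f1, f2)], and functionals [f1], [f2] each
    vanishing at exactly one point of their blocking set combine to a functional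
    showing that a prescribed point of the new set cannot be dropped. *)
Require Import Defs.
From mathcomp Require Import all_boot all_algebra.

Import GRing.Theory.
Local Open Scope ring_scope.

Section Points.

Variables (F : finFieldType) (n : nat).
Implicit Types (P Q : pg_point F n) (v w : 'rV[F]_n.+1) (f : 'cV[F]_n.+1).
Implicit Types (B : {set pg_point F n}).

(** * Representative vectors of projective points *)

Definition point_rep P : 'rV[F]_n.+1 := vpick (val P).

Lemma point_rep_neq0 P : point_rep P != 0.
Proof. by rewrite /point_rep vpick0 -dimv_eq0 (eqP (valP P)). Qed.

Lemma val_point_rep P : val P = <[point_rep P]>%VS.
Proof.
apply/eqP; rewrite eq_sym eqEdim -memvE memv_pick /=.
by rewrite (eqP (valP P)) dim_vline point_rep_neq0.
Qed.

Lemma const1_line_dim : \dim <[const_mx 1 : 'rV[F]_n.+1]> == 1%N.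
Proof.
rewrite dim_vline; suff -> : (const_mx 1 : 'rV[F]_n.+1) != 0 by [].
by apply/matrix0Pn; exists 0, 0; rewrite mxE oner_neq0.
Qed.

(* Junk value: [point_of 0] is the point spanned by the all-ones vector. *)
Definition point_of v : pg_point F n :=
  insubd (Sub <[const_mx 1]>%VS const1_line_dim : pg_point F n) <[v]>%VS.

Lemma val_point_of v : v != 0 -> val (point_of v) = <[v]>%VS.
Proof. by move=> v0; rewrite val_insubd dim_vline v0. Qed.

Lemma point_of_eq v w :
  v != 0 -> w != 0 -> point_of v = point_of w -> exists a, v = a *: w.
Proof.
move=> v0 w0 eq_vw; apply/vlineP.
by rewrite -(val_point_of w) // -eq_vw val_point_of // memv_line.
Qed.

Lemma point_rep_inj_line P Q a : point_rep P = a *: point_rep Q -> P = Q.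
Proof.
move=> eqPQ; apply: val_inj; apply/eqP.
rewrite eqEdim (eqP (valP P)) (eqP (valP Q)) leqnn andbT.
by rewrite (val_point_rep P) -memvE val_point_rep eqPQ memvZ ?memv_line.
Qed.

(** A column [f] encodes the linear functional [v |-> v *m f]. *)
Definition vanish_at f P : bool := point_rep P *m f == 0.

(** The representative chosen for [point_of v] is a nonzero multiple of [v], so vanishing does not
    depend on that choice. *)
Lemma vanish_at_point_of f v :
  v != 0 -> vanish_at f (point_of v) = (v *m f == 0).
Proof.
move=> v0; have /vlineP[a rep_a] : point_rep (point_of v) \in <[v]>%VS.
  by rewrite -val_point_of // memv_pick.
have := point_rep_neq0 (point_of v).
rewrite /vanish_at rep_a scaler_eq0 negb_or => /andP[a0 _].
by rewrite -scalemxAl scaler_eq0 (negPf a0).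
Qed.

Lemma vanish_at0 P : vanish_at 0 P.
Proof. by rewrite /vanish_at mulmx0. Qed.

(** * Hyperplanes as kernels of functionals *)

Definition functional_ker f : {vspace 'rV[F]_n.+1} :=
  lker (linfun (mulmxr f : 'rV[F]_n.+1 -> 'rV[F]_1)).

Lemma mem_functional_ker f v : (v \in functional_ker f) = (v *m f == 0).
Proof. by rewrite memv_ker lfunE. Qed.

Lemma incident_functional_ker f P : (val P <= functional_ker f)%VS = vanish_at f P.
Proof. by rewrite val_point_rep -memvE mem_functional_ker. Qed.

(** By rank-nullity it suffices that the image is a line. It lies in a one-dimensional space, and it
    is nonzero because the values on the unit vectors are the entries of [f]. *)
Lemma dim_functional_ker f : f != 0 -> \dim (functional_ker f) = n.
Proof.
move=> f0; have := limg_ker_dim (linfun (mulmxr f : 'rV[F]_n.+1 -> 'rV[F]_1)) fullv.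
rewrite capfv -/(functional_ker f) dimvf /dim /= mul1n.
set L := limg _ => dimE.
suff L1 : \dim L = 1%N by move: dimE; rewrite L1 addn1 => -[].
have le1 : (\dim L <= 1)%N.
  by apply: leq_trans (dimvS (subvf L)) _; rewrite dimvf /dim /= mul1n.
apply/eqP; rewrite eqn_leq le1 lt0n dimv_eq0.
apply: contraNneq f0 => L0; apply/eqP/row_matrixP => i.
have : linfun (mulmxr f : 'rV[F]_n.+1 -> 'rV[F]_1) (delta_mx 0 i) \in L.
  by rewrite memv_img ?memvf.
by rewrite L0 memv0 lfunE /= -rowE row0 => /eqP.
Qed.

(** The rows of [M] form a basis of [H], so [M] has rank at most [n] and a nonzero cokernel matrix.
    A nonzero column of that matrix annihilates [H], and equal dimensions turn inclusion in its
    kernel into equality. *)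
Lemma hyperplane_functional (H : {vspace 'rV[F]_n.+1}) :
  \dim H = n -> exists2 f, f != 0 & H = functional_ker f.
Proof.
move=> dimH; pose M := \matrix_(i < \dim H) (vbasis H)`_i.
have [f f0 Mf] : exists2 f : 'cV_n.+1, f != 0 & M *m f = 0.
  have : cokermx M != 0.
    rewrite -mxrank_eq0 mxrank_coker subn_eq0 -ltnNge ltnS.
    by rewrite (leq_trans (rank_leq_row M)) // dimH.
  case/matrix0Pn=> i [j Mij]; exists (col j (cokermx M)).
    by apply/matrix0Pn; exists i, 0; rewrite mxE.
  by rewrite colE mulmxA mulmx_coker mul0mx.
exists f => //; apply/eqP; rewrite eqEdim dim_functional_ker ?dimH ?leqnn ?andbT //.
apply/subvP => v /coord_vbasis ->; apply: memv_suml => k _; apply: memvZ => /=.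
rewrite mem_functional_ker -[(vbasis H)`_k](rowK (fun i : 'I__ => (vbasis H)`_i)).
by rewrite -row_mul Mf linear0.
Qed.

(** * Blocking sets in terms of functionals *)

Lemma blocking_setP B :
  reflect (forall f, f != 0 -> exists2 P, P \in B & vanish_at f P)
          (blocking_set B).
Proof.
apply: (iffP forallP) => [blB f f0 | blB H].
  have dimf : \dim (functional_ker f) == n by rewrite dim_functional_ker.
  have /exists_inP[P BP] := blB (Sub (functional_ker f) dimf : pg_hyperplane F n).
  by rewrite /incident SubK incident_functional_ker; exists P.
have [f f0 Hf] := hyperplane_functional (val H) (eqP (valP H)).
have [P BP fP] := blB f f0; apply/exists_inP; exists P => //.
by rewrite /incident Hf incident_functional_ker.
Qed.

(** Tangent hyperplanes: one that misses [B :\ P] meets [B] in [P] alone. Conversely, a blocking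
    subset of [B] must contain the only point of [B] on such a hyperplane. *)
Lemma minimal_blocking_setP B :
  minimal_blocking_set B <->
  blocking_set B /\
  forall P, P \in B ->
    exists2 f : 'cV_n.+1, f != 0 & forall Q, Q \in B -> vanish_at f Q = (Q == P).
Proof.
split=> [/minsetP[blB minB] | [blB tanB]].
  split=> // P BP.
  have /blocking_setP nblBP : ~~ blocking_set (B :\ P).
    apply/negP => /minB/(_ (subsetDl _ _))/setP/(_ P).
    by rewrite !inE eqxx BP.
  have [f /andP[f0 /forall_inP tan]] :
      exists f, (f != 0) && [forall (Q | Q \in B :\ P), ~~ vanish_at f Q].
    apply/existsP/contraT; rewrite negb_exists => /forallP noF.
    exfalso; apply: nblBP => f f0; have := noF f; rewrite f0 negb_forall_in.
    by case/exists_inP=> Q BQ; rewrite negbK; exists Q.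
  exists f => // Q BQ; have [-> | neqQP] := eqVneq Q P; last first.
    by apply/negbTE/tan; rewrite !inE neqQP.
  have [R BR fR] := blocking_setP B blB f f0.
  have [<- // | neqRP] := eqVneq R P.
  by have := tan R; rewrite !inE neqRP BR fR => /(_ isT).
apply/minsetP; split=> // A /blocking_setP blA subAB.
apply/eqP; rewrite eqEsubset subAB; apply/subsetP => P BP.
have [f f0 tan] := tanB P BP; have [Q AQ] := blA f f0.
by rewrite tan ?(subsetP subAB) // => /eqP <-.
Qed.

End Points.

Arguments vanish_at {F n}.
Arguments point_of {F n}.
Arguments point_rep {F n}.

(** * Gluing two minimal blocking sets *)

Lemma direct_sum_mx (R : pzSemiRingType) (a b m : nat) :
  (a + b)%N = m ->
  exists (C1 : 'M[R]_(a, m)) (C2 : 'M[R]_(b, m))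
         (D1 : 'M[R]_(m, a)) (D2 : 'M[R]_(m, b)),
    [/\ C1 *m D1 = 1%:M, C1 *m D2 = 0, C2 *m D1 = 0 & C2 *m D2 = 1%:M].
Proof.
(* [C1], [C2] embed the two summands as coordinate subspaces; [D1], [D2] are the projections onto
   them. *)
move=> <-; exists (row_mx 1%:M 0), (row_mx 0 1%:M), (col_mx 1%:M 0), (col_mx 0 1%:M).
by split; rewrite mul_row_col ?mul0mx ?mulmx0 ?mul1mx ?addr0 ?add0r.
Qed.

(** Keeping [m] arbitrary, tied by an equation between vector space dimensions, avoids casts between
    types of row vectors. *)
Lemma minimal_blocking_set_join (F : finFieldType) (n1 n2 m : nat)
    (B1 : {set pg_point F n1}) (B2 : {set pg_point F n2}) :
  (n1.+1 + n2.+1)%N = m.+1 -> B1 != set0 -> B2 != set0 ->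
  minimal_blocking_set B1 -> minimal_blocking_set B2 ->
  exists B : {set pg_point F m},
    minimal_blocking_set B /\ #|B| = (#|B1| + #|B2| - 1)%N.
Proof.
move=> /(direct_sum_mx F)[C1 [C2 [D1 [D2 [C1D1 C1D2 C2D1 C2D2]]]]].
move=> /set0Pn[P1 BP1] /set0Pn[P2 BP2].
move=> /minimal_blocking_setP[/blocking_setP bl1 tan1].
move=> /minimal_blocking_setP[/blocking_setP bl2 tan2].
pose w1 (P : pg_point F n1) := point_rep P *m C1.
pose w2 (P : pg_point F n2) := point_rep P *m C2.
pose r := w1 P1 + w2 P2.
have w1D1 P : w1 P *m D1 = point_rep P by rewrite -mulmxA C1D1 mulmx1.
have w1D2 P : w1 P *m D2 = 0 by rewrite -mulmxA C1D2 mulmx0.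
have w2D1 P : w2 P *m D1 = 0 by rewrite -mulmxA C2D1 mulmx0.
have w2D2 P : w2 P *m D2 = point_rep P by rewrite -mulmxA C2D2 mulmx1.
have rD1 : r *m D1 = point_rep P1 by rewrite mulmxDl w1D1 w2D1 addr0.
have rD2 : r *m D2 = point_rep P2 by rewrite mulmxDl w1D2 w2D2 add0r.
have w1_neq0 P : w1 P != 0.
  by apply: contraNneq (point_rep_neq0 _ _ P) => w0; rewrite -w1D1 w0 mul0mx.
have w2_neq0 P : w2 P != 0.
  by apply: contraNneq (point_rep_neq0 _ _ P) => w0; rewrite -w2D2 w0 mul0mx.
have r_neq0 : r != 0.
  by apply: contraNneq (point_rep_neq0 _ _ P1) => r0; rewrite -rD1 r0 mul0mx.
pose e1 P : pg_point F m := point_of (w1 P).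
pose e2 P : pg_point F m := point_of (w2 P).
pose R : pg_point F m := point_of r.
(* Projecting a proportionality by [D1] or [D2] shows that all the points [e1 P], [e2 Q] and [R] are
   distinct. *)
have e1_inj : injective e1.
  move=> P Q /point_of_eq[] // a eqPQ; apply: (point_rep_inj_line _ _ _ _ a).
  by rewrite -!w1D1 eqPQ -scalemxAl.
have e2_inj : injective e2.
  move=> P Q /point_of_eq[] // a eqPQ; apply: (point_rep_inj_line _ _ _ _ a).
  by rewrite -!w2D2 eqPQ -scalemxAl.
have e12 P Q : (e1 P == e2 Q) = false.
  apply: contraNF (point_rep_neq0 _ _ P) => /eqP/point_of_eq[] // a eqPQ.
  by rewrite -w1D1 eqPQ -scalemxAl w2D1 scaler0.
have e1R P : (R == e1 P) = false.
  apply: contraNF (point_rep_neq0 _ _ P2) => /eqP/point_of_eq[] // a eqPR.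
  by rewrite -rD2 eqPR -scalemxAl w1D2 scaler0.
have e2R P : (R == e2 P) = false.
  apply: contraNF (point_rep_neq0 _ _ P1) => /eqP/point_of_eq[] // a eqPR.
  by rewrite -rD1 eqPR -scalemxAl w2D1 scaler0.
have van1 f P : vanish_at f (e1 P) = vanish_at (C1 *m f) P.
  by rewrite vanish_at_point_of // /vanish_at mulmxA.
have van2 f P : vanish_at f (e2 P) = vanish_at (C2 *m f) P.
  by rewrite vanish_at_point_of // /vanish_at mulmxA.
have vanR f : vanish_at f R =
    (point_rep P1 *m (C1 *m f) + point_rep P2 *m (C2 *m f) == 0).
  by rewrite vanish_at_point_of // mulmxDl !mulmxA.
pose A1 := e1 @: (B1 :\ P1); pose A2 := e2 @: (B2 :\ P2).
have inA1 Q : Q \in A1 -> exists P, [/\ Q = e1 P, P \in B1 & P != P1].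
  by case/imsetP=> P; rewrite !inE => /andP[? ?] ->; exists P.
have inA2 Q : Q \in A2 -> exists P, [/\ Q = e2 P, P \in B2 & P != P2].
  by case/imsetP=> P; rewrite !inE => /andP[? ?] ->; exists P.
have R_A12 : R \notin A1 :|: A2.
  apply/negP; rewrite inE => /orP[/inA1 | /inA2] [P [/eqP]].
    by rewrite e1R.
  by rewrite e2R.
have A12_disj : [disjoint A1 & A2].
  apply/pred0P => Q /=; apply/negP => /andP[/inA1[P [-> _ _]] /inA2[P' [/eqP]]].
  by rewrite e12.
exists (R |: (A1 :|: A2)); split; last first.
  (* The count is 1 + (#|B1| - 1) + (#|B2| - 1). *)
  rewrite cardsU1 R_A12 cardsU (disjoint_setI0 A12_disj) cards0 subn0.
  rewrite !card_imset // (cardsD1 P1 B1) (cardsD1 P2 B2) BP1 BP2.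
  by rewrite -!addnA add1n subn1 /= add0n add1n addnS.
(* Functionals on the summands glue along the projections; the result is nonzero because its
   restriction [f1] is. *)
have joint (f1 : 'cV_n1.+1) (f2 : 'cV_n2.+1) :
    f1 != 0 -> exists f, [/\ f != 0, C1 *m f = f1 & C2 *m f = f2].
  move=> f10; exists (D1 *m f1 + D2 *m f2).
  have C1f : C1 *m (D1 *m f1 + D2 *m f2) = f1.
    by rewrite mulmxDr !mulmxA C1D1 C1D2 mul1mx mul0mx addr0.
  split=> //; last by rewrite mulmxDr !mulmxA C2D1 C2D2 mul1mx mul0mx add0r.
  by apply: contraNneq f10 => f0; rewrite -C1f f0 mulmx0.
apply/minimal_blocking_setP; split.
  apply/blocking_setP => f f0.
  have [/existsP[Q /andP[AQ fQ]] | noQ] :=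
      boolP [exists Q, (Q \in A1 :|: A2) && vanish_at f Q].
    by exists Q; rewrite // inE AQ orbT.
  exists R; rewrite ?setU11 // vanR.
  have miss Q : Q \in A1 :|: A2 -> ~~ vanish_at f Q.
    by move=> AQ; apply: contra noQ => fQ; apply/existsP; exists Q; rewrite AQ.
  (* Either the restriction of [f] is zero, or it vanishes at a point of [B1], which must be [P1]
     since [f] misses [A1]. *)
  have /eqP -> : vanish_at (C1 *m f) P1.
    have [-> | /bl1[P BP fP]] := eqVneq (C1 *m f) 0; first exact: vanish_at0.
    have [<- // | neqP] := eqVneq P P1.
    have := miss (e1 P); rewrite van1 fP inE mem_imset // !inE neqP BP.
    by move/(_ isT).
  have /eqP -> : vanish_at (C2 *m f) P2.
    have [-> | /bl2[P BP fP]] := eqVneq (C2 *m f) 0; first exact: vanish_at0.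
    have [<- // | neqP] := eqVneq P P2.
    have := miss (e2 P); rewrite van2 fP inE [X in _ || X]mem_imset // !inE.
    by rewrite neqP BP orbT => /(_ isT).
  by rewrite addr0.
move=> Q; rewrite !inE.
case/or3P=> [/eqP-> | /inA1[S1 [-> BS1 neqS1]] | /inA2[S2 [-> BS2 neqS2]]].
(* For [R], glue tangent functionals at [P1] and [P2]: both terms of the value at [R] are zero. *)
- have [f1 f10 tf1] := tan1 P1 BP1; have [f2 _ tf2] := tan2 P2 BP2.
  have [f [f0 C1f C2f]] := joint f1 f2 f10; exists f => // Q'; rewrite !inE.
  case/or3P=> [/eqP-> | /inA1[P [-> BP neqP]] | /inA2[P [-> BP neqP]]].
  + have /eqP p1 : vanish_at f1 P1 by rewrite tf1.
    have /eqP p2 : vanish_at f2 P2 by rewrite tf2.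
    by rewrite vanR C1f C2f p1 p2 addr0 !eqxx.
  + by rewrite van1 C1f tf1 // (negPf neqP) eq_sym e1R.
  + by rewrite van2 C2f tf2 // (negPf neqP) eq_sym e2R.
(* For [e1 S1], glue tangent functionals at [S1] and [P2]. The value at [R] reduces to that of [f1]
   at [P1], nonzero since [S1 != P1]; [f2] misses every point of [B2 :\ P2]. *)
- have [f1 f10 tf1] := tan1 S1 BS1; have [f2 _ tf2] := tan2 P2 BP2.
  have [f [f0 C1f C2f]] := joint f1 f2 f10; exists f => // Q'; rewrite !inE.
  case/or3P=> [/eqP-> | /inA1[P [-> BP neqP]] | /inA2[P [-> BP neqP]]].
  + have /eqP p2 : vanish_at f2 P2 by rewrite tf2.
    rewrite vanR C1f C2f p2 addr0 -/(vanish_at f1 P1) tf1 // e1R.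
    by rewrite eq_sym (negPf neqS1).
  + by rewrite van1 C1f tf1 // (inj_eq e1_inj).
  + by rewrite van2 C2f tf2 // (negPf neqP) eq_sym e12.
(* The symmetric case [e2 S2], with tangent functionals at [P1] and [S2]. *)
have [f1 f10 tf1] := tan1 P1 BP1; have [f2 _ tf2] := tan2 S2 BS2.
have [f [f0 C1f C2f]] := joint f1 f2 f10; exists f => // Q'; rewrite !inE.
case/or3P=> [/eqP-> | /inA1[P [-> BP neqP]] | /inA2[P [-> BP neqP]]].
- have /eqP p1 : vanish_at f1 P1 by rewrite tf1.
  rewrite vanR C1f C2f p1 add0r -/(vanish_at f2 P2) tf2 // e2R.
  by rewrite eq_sym (negPf neqS2).
- by rewrite van1 C1f tf1 // (negPf neqP) e12.
by rewrite van2 C2f tf2 // (inj_eq e2_inj).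
Qed.

Local Close Scope ring_scope.

Theorem corollary1p2 (q : nat) (F : finFieldType) (hF : #|F| = q)
    (n1 n2 : nat) (hn1 : 0 < n1) (hn2 : 0 < n2)
    (k1 k2 : nat) (hk1 : 0 < k1) (hk2 : 0 < k2)
    (h1 : exists B : {set pg_point F n1}, minimal_blocking_set B /\ #|B| = k1)
    (h2 : exists B : {set pg_point F n2}, minimal_blocking_set B /\ #|B| = k2) :
  exists B : {set pg_point F (n1 + n2 + 1)},
    minimal_blocking_set B /\ #|B| = k1 + k2 - 1.
Proof.
case: h1 h2 => [B1 [minB1 cB1]] [B2 [minB2 cB2]].
(* Positive sizes provide the points [P1] and [P2] to be merged. *)
rewrite -cB1 -cB2; apply: minimal_blocking_set_join => //.
- by rewrite addSn addnS addn1.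
- by rewrite -card_gt0 cB1.
- by rewrite -card_gt0 cB2.
Qed.
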